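(* Let $H\in(0,1)$. The following assertions hold. (a) For all $h\in[0,1)$ and $t\in[0,1-h]$, $$\max_{x\in\mathfrak X^H}|x(t+h)-x(t)|\le 2^{1-H}\omega_H(h).$$ (b) The inequality from part (a) is sharp in the sense that $$\limsup_{h\downarrow0}\max_{t\in[0,1-h]}\frac{|\widetilde x^H(t+h)-\widetilde x^H(t)|}{\omega_H(h)}=2^{1-H}.$$ In particular, the function $2^{1-H}\omega_H(h)$ is a uniform modulus of continuity for the class $\mathfrak X^H$: $$\limsup_{h\downarrow0}\sup_{x\in\mathfrak X^H}\max_{t\in[0,1-h]}\frac{|x(t+h)-x(t)|}{2^{1-H}\omega_H(h)}=\limsup_{h\downarrow0}\max_{t\in[0,1-h]}\frac{|\widetilde x^H(t+h)-\widetilde x^H(t)|}{2^{1-H}\omega_H(h)}=1.$$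
   Context: Faber--Schauder functions: for $t\in\mathbb R$, $e_{0,0}(t):=(\min\{t,1-t\})^+$ and $e_{m,k}(t):=2^{-m/2}e_{0,0}(2^mt-k)$ for $m\ge 1$, $k\in\mathbb Z$. For $H\in(0,1)$, the class of signed Takagi--Landsberg functions is $$\mathfrak X^H=\Big\{x\in C[0,1]\ \Big|\ x=\sum_{m=0}^\infty 2^{m(\frac12-H)}\sum_{k=0}^{2^m-1}\theta_{m,k}e_{m,k}\ \text{ for coefficients }\theta_{m,k}\in\{-1,+1\}\Big\},$$ where the series converges uniformly on $[0,1]$ for every choice of the $\theta_{m,k}$. The function $\widetilde x^H\in\mathfrak X^H$ is $$\widetilde x^H=e_{0,0}+\sum_{m=1}^\infty 2^{m(\frac12-H)}\left(\sum_{k=0}^{2^{m-1}-1}e_{m,k}-\sum_{k=2^{m-1}}^{2^m-1}e_{m,k}\right).$$ For $h>0$ let $\nu(h)=\lfloor-\log_2h\rfloor$, where $\lfloor a\rfloor$ is the largest integer not exceeding $a$, and define $$\omega_H(h)=\frac{h\,2^{(\nu(h)-1)(1-H)}}{2^{1-H}-1}+\frac{2^{(1-\nu(h))H}}{3(1-2^{-H})}.$$ By convention $\omega_H(0):=0$. *)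

(* Defs.v *)
From HB Require Import structures.
From mathcomp Require Import all_boot all_order all_algebra.
From mathcomp Require Import all_classical all_reals all_analysis.
Set Implicit Arguments.
Unset Strict Implicit.
Unset Printing Implicit Defensive.
Import Order.TTheory GRing.Theory Num.Theory.
Import numFieldNormedType.Exports.
Local Open Scope classical_set_scope.
Local Open Scope ring_scope.

Definition schauder00 {R : realType} (t : R) : R :=
  Num.max (Num.min t (1 - t)) 0.

(* For [m = k = 0] this is [schauder00]. *)
Definition schauder {R : realType} (m : nat) (k : int) (t : R) : R :=
  2 `^ (- (m%:R / 2)) * schauder00 (2 ^+ m * t - k%:~R).

Definition TL_partial {R : realType} (H : R) (theta : nat -> nat -> R)
    (n : nat) (t : R) : R :=
  \sum_(0 <= m < n) 2 `^ (m%:R * (2^-1 - H)) *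
    \sum_(0 <= k < 2 ^ m) theta m k * schauder m k t.

(* Elements of C[0,1] are represented by functions on R that are continuous
   on [0,1]; their values outside [0,1] are irrelevant. *)
Definition signed_TL {R : realType} (H : R) : set (R -> R) :=
  [set x : R -> R | {within `[0, 1]%classic, continuous x} /\
    exists theta : nat -> nat -> R,
      (forall m k, (k < 2 ^ m)%N -> theta m k = -1 \/ theta m k = 1) /\
      {uniform `[0, 1]%classic, TL_partial H theta n @[n --> \oo] --> x}].

Definition xtilde {R : realType} (H : R) (t : R) : R :=
  schauder00 t +
  limn (fun n => \sum_(1 <= m < n) 2 `^ (m%:R * (2^-1 - H)) *
    (\sum_(0 <= k < 2 ^ m.-1) schauder m k t -
     \sum_(2 ^ m.-1 <= k < 2 ^ m) schauder m k t)).

Definition nu {R : realType} (h : R) : int := Num.floor (- (ln h / ln 2)).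

(* The formula is meant for [h > 0]; [omega H 0 = 0] by convention. *)
Definition omega {R : realType} (H h : R) : R :=
  if 0 < h then
    h * 2 `^ (((nu h)%:~R - 1) * (1 - H)) / (2 `^ (1 - H) - 1) +
    2 `^ ((1 - (nu h)%:~R) * H) / (3 * (1 - 2 `^ (- H)))
  else 0.

(* [max A = M], including the assertion that the maximum is attained *)
Definition is_max {R : realType} (A : set R) (M : R) : Prop :=
  A M /\ ubound A M.

Definition increments_at {R : realType} (X : set (R -> R)) (h t : R) : set R :=
  [set `|x (t + h) - x t| | x in X].

Definition increment_ratios {R : realType} (x : R -> R) (w : R -> R) (h : R)
  : set R :=
  [set `|x (t + h) - x t| / w h | t in `[0, 1 - h]%classic].

Definition limsup_at0 {R : realType} (f : R -> \bar R) : \bar R :=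
  limf_esup f (0 : R)^'+.

(* Main.v *)
Require Import Defs.
From mathcomp Require Import all_boot all_order all_algebra.
From mathcomp Require Import all_classical all_reals all_analysis.
From mathcomp Require Import ring lra.
Set Implicit Arguments.
Unset Strict Implicit.
Unset Printing Implicit Defensive.
Import Order.TTheory GRing.Theory Num.Theory.
Import numFieldNormedType.Exports.
Local Open Scope classical_set_scope.
Local Open Scope ring_scope.

(* Put a = 2^-H and b = 2 a = 2^(1-H). On [0,1] the m-th level of a function
   in the class is a^m times a signed triangle wave of 2^m t; it is bounded by
   a^m dist(2^m t, Z), and its increments over h by a^m 2^m h. With n = nu h,
   use the Lipschitz bound for the levels m < n and, for the levels m >= n,
   sum_j a^j dist(2^j s, Z) <= 1 / (3 (1 - a)) at both end points: this gives
   h b^n / (b - 1) + 2 a^n / (3 (1 - a)) = b omega(h). The maximum over the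
   class is attained by taking as signs those of the Schauder increments.
   For sharpness, take h = (2/3) 2^-n and the increment of xtilde between
   1/2 - h/2 and 1/2 + h/2, about which the levels m >= 1 are antisymmetric.
   There dist(2^m h/2, Z) is 2^m h/2 for m < n and 1/3 for m >= n, so that
   the increment is b omega(h) - h b / (b - 1), and h / omega(h) -> 0. *)

(** * Distance to the nearest integer *)

Section distance_to_integers.
Context {R : realType}.
Implicit Types (s : R) (k : int).

Definition zdist s : R :=
  Num.min (s - (Num.floor s)%:~R) (1 - (s - (Num.floor s)%:~R)).

Lemma floor_bounds s : (Num.floor s)%:~R <= s < (Num.floor s)%:~R + 1.
Proof. by have := floor_itv s; rewrite intrD. Qed.

Lemma zdist_ge0 s : 0 <= zdist s.
Proof.
by have fs := floor_bounds s; rewrite /zdist le_min; apply/andP; split; lra.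
Qed.

Lemma zdist_le_half s : zdist s <= 1 / 2.
Proof. by rewrite /zdist; case: (leP (s - _)) => ?; lra. Qed.

Lemma zdist_le s k : zdist s <= `|s - k%:~R|.
Proof.
have := floor_bounds s; set f := Num.floor s => fs.
have [kf|fk] := leP k f.
  have : k%:~R <= f%:~R :> R by rewrite ler_int.
  rewrite /zdist -/f => ?; apply: le_trans (ler_norm _).
  by rewrite ge_min; apply/orP; left; lra.
have : f%:~R + 1 <= k%:~R :> R by rewrite -intrD1 ler_int lezD1.
rewrite /zdist -/f => ?; rewrite distrC; apply: le_trans (ler_norm _).
by rewrite ge_min; apply/orP; right; lra.
Qed.

Lemma zdist_attained s : exists k, zdist s = `|s - k%:~R|.
Proof.
have := floor_bounds s; set f := Num.floor s => fs.
rewrite /zdist -/f; case: (leP (s - _)) => _.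
  by exists f; rewrite ger0_norm; lra.
by exists (f + 1); rewrite intrD ler0_norm; lra.
Qed.

(** Distinct integers are at least 1 apart, so no other integer is strictly closer than one at
    distance at most 1/2. *)
Lemma zdistE s k : `|s - k%:~R| <= 1 / 2 -> zdist s = `|s - k%:~R|.
Proof.
move=> sk; apply/le_anti; rewrite zdist_le /=.
have [j sj] := zdist_attained s; rewrite sj.
have [->//|jk] := eqVneq j k.
have : 1 <= `|(j - k)%:~R : R|.
  by rewrite -intr_norm ler1z -gtz0_ge1 normr_gt0 subr_eq0.
have := ler_normB (s - k%:~R) (s - j%:~R).
have -> : s - k%:~R - (s - j%:~R) = (j - k)%:~R :> R by rewrite intrB; lra.
lra.
Qed.

Lemma zdistN s : zdist (- s) = zdist s.
Proof.
have [k sk] := zdist_attained s.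
have e : `|- s - (- k)%:~R| = `|s - k%:~R| by rewrite -normrN intrN opprB opprK addrC.
by rewrite sk -e; apply: zdistE; rewrite e -sk zdist_le_half.
Qed.

Lemma zdistDz s k : zdist (s + k%:~R) = zdist s.
Proof.
have [j sj] := zdist_attained s.
have e : `|s + k%:~R - (j + k)%:~R| = `|s - j%:~R| by rewrite intrD; congr `|_|; lra.
by rewrite sj -e; apply: zdistE; rewrite e -sj zdist_le_half.
Qed.

(** With u the fractional part of [s], the odd integer 2 floor(s) + 1 lies at distance |1 - 2u| = 1
    - 2 [zdist s] from 2s. *)
Lemma zdist_double s : zdist (2 * s) + 2 * zdist s <= 1.
Proof.
have := zdist_le (2 * s) (Num.floor s + Num.floor s + 1).
rewrite !intrD [zdist s]/zdist; have := floor_bounds s.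
by set f := _%:~R => fs; case: (leP (s - f)) => ?; case: ler0P => ?; lra.
Qed.

(** If 2^n / 3 = k + e/3 with e = 1 or e = -1, then 2^(n+1) / 3 = (2k + e) - e/3, so the distance
    1/3 persists. *)
Lemma zdist_pow2_third (n : nat) : zdist (2 ^+ n / 3) = 1 / 3.
Proof.
have [k nk] : exists k, `|2 ^+ n / 3 - k%:~R| = 1 / 3 :> R.
  elim: n => [|n [k]].
    by exists 0; rewrite expr0 subr0 ger0_norm; lra.
  rewrite exprS; case: ler0P => _ nk.
    by exists (k + k - 1); rewrite !(intrD, intrN) ger0_norm; lra.
  by exists (k + k + 1); rewrite !intrD ler0_norm; lra.
by rewrite (@zdistE _ k) nk//; lra.
Qed.

(* The value 1/3 is the fixed point of the bound [u -> 1 - 2 u] given by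
   [zdist_double]; if [zdist s > 1/3], the excess is compensated by the next
   term, because [1/2 <= a]. *)
Lemma sum_zdist_le (a : R) (N : nat) s : 1 / 2 <= a -> a < 1 ->
  \sum_(0 <= m < N) a ^+ m * zdist (2 ^+ m * s) <= (3 * (1 - a))^-1.
Proof.
move=> a_ge a_lt; set c := (_)^-1.
have cE : c = 1 / 3 + a * c by rewrite /c; field; apply/eqP; lra.
have c_ge : 2 / 3 <= c by nra.
(* The induction covers all shorter sums and all points, because one case removes two terms at
   once. *)
suff : forall n M s', (M <= n)%N ->
    \sum_(0 <= m < M) a ^+ m * zdist (2 ^+ m * s') <= c.
  by move=> /(_ N N s (leqnn N)).
elim=> [|n IH] M s' Mn.
  by move: Mn; rewrite leqn0 => /eqP ->; rewrite big_nil; lra.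
have shift K r : \sum_(0 <= m < K.+1) a ^+ m * zdist (2 ^+ m * r) =
    zdist r + a * \sum_(0 <= m < K) a ^+ m * zdist (2 ^+ m * (2 * r)).
  rewrite big_nat_recl// !expr0 !mul1r mulr_sumr; congr (_ + _).
  by apply: eq_bigr => i _; rewrite (exprS a) (exprSr 2) !mulrA.
have := zdist_le_half s'; have := zdist_double s'.
have := zdist_ge0 (2 * s').
case: M Mn => [_|M]; first by rewrite big_nil; lra.
rewrite ltnS shift => Mn ? ? ?.
have [small|big] := leP (zdist s') (1 / 3).
  by have := IH _ (2 * s') Mn; nra.
case: M Mn => [_|M Mn]; first by rewrite big_nil; lra.
rewrite shift.
set S := (X in _ + a * (_ + a * X)).
have Sc : S <= c := IH _ _ (ltnW Mn).
(* Write z for [zdist s']. The first two terms are at most z + a (1 - 2z) <= 1/3 + a/3, as z > 1/3,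
   and the rest is at most a^2 c; by [cE] these bounds add up to c. *)
have : a * (a * S) <= a * (a * c) by rewrite !ler_pM2l//; lra.
have : 0 <= a * (1 - (zdist (2 * s') + 2 * zdist s')) by apply: mulr_ge0; lra.
have : 0 <= (2 * a - 1) * (zdist s' - 1 / 3) by apply: mulr_ge0; lra.
have : a * c = a / 3 + a * (a * c) by rewrite {1}cE; lra.
lra.
Qed.

End distance_to_integers.

(** * Signed triangle waves *)

Section wave.
Context {R : realType}.
Implicit Types (th : nat -> R) (n : nat) (s : R).

(** Up to the factor [a ^+ m], level [m] of the series at [t] is this sum with [n = 2 ^ m], taken at
    [s = 2 ^+ m * t]. *)
Definition wave n th s : R := \sum_(0 <= k < n) th k * schauder00 (s - k%:R).

(** The sign on the cell [k, k + 1), extended by 0 to the cells without a tent, so that [waveE]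
    holds on the whole line. *)
Definition wave_coef n th (k : int) : R :=
  if k is Posz j then if (j < n)%N then th j else 0 else 0.

Lemma schauder00_eq0 s : s <= 0 \/ 1 <= s -> schauder00 s = 0.
Proof.
move=> s01; apply/max_idPr; rewrite ge_min.
by apply/orP; case: s01 => ?; [left|right]; lra.
Qed.

Lemma schauder00_zdist s k : k%:~R <= s < k%:~R + 1 ->
  schauder00 (s - k%:~R) = zdist s.
Proof.
move=> sk; have fk : Num.floor s = k by apply: floor_def; rewrite intrD.
rewrite /schauder00 /zdist fk; apply/max_idPl; rewrite le_min.
by apply/andP; split; lra.
Qed.

(** The supports of the tents have disjoint interiors, so only the tent over the cell of [s]
    contributes. *)
Lemma waveE n th s : wave n th s = wave_coef n th (Num.floor s) * zdist s.
Proof.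
have := floor_bounds s; rewrite /wave; case E : (Num.floor s) => [j|j] sj.
  rewrite (eq_bigr (fun k => if k == j then th k * zdist s else 0)).
    rewrite -big_mkcond big_nat1_eq /=.
    by case: ifP => _; rewrite ?mul0r.
  move=> k _; case: eqP => [->|/eqP kj]; first by rewrite pmulrn schauder00_zdist.
  rewrite schauder00_eq0 ?mulr0//.
  have [jk|jk] : (j.+1 <= k)%N \/ (k.+1 <= j)%N.
  - by move: kj; rewrite neq_ltn => /orP[]; [right|left].
  - left; have : j.+1%:R <= k%:R :> R by rewrite ler_nat.
    by rewrite -natr1; move: sj; rewrite -pmulrn; lra.
  - right; have : k.+1%:R <= j%:R :> R by rewrite ler_nat.
    by rewrite -natr1; move: sj; rewrite -pmulrn; lra.
rewrite mul0r big1// => k _; rewrite schauder00_eq0 ?mulr0//; left.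
have : 0 <= k%:R :> R by [].
have : 1 <= j.+1%:R :> R by rewrite ler1n.
by move: sj; rewrite NegzE intrN -pmulrn; lra.
Qed.

Lemma wave_coef_le1 n th k : (forall j, (j < n)%N -> th j = -1 \/ th j = 1) ->
  `|wave_coef n th k| <= 1.
Proof.
case: k => [j|j] /= th1; last by rewrite normr0.
case: ifP => [/th1[]->|_]; by rewrite ?normrN ?normr1 ?normr0.
Qed.

Lemma wave_le_zdist n th s : (forall j, (j < n)%N -> th j = -1 \/ th j = 1) ->
  `|wave n th s| <= zdist s.
Proof.
move=> /wave_coef_le1 th1; rewrite waveE normrM (ger0_norm (zdist_ge0 s)).
exact: ler_piMl (zdist_ge0 _) (th1 _).
Qed.

(** Within a cell the coefficient is constant and [zdist] is 1-Lipschitz. Across cells, the two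
    values are bounded by the distances from [s] up to the end of its cell and from [s'] down to the
    start of its own, which are lengths of non-overlapping pieces of [s, s']. *)
Lemma wave_lipschitz n th s s' : (forall j, (j < n)%N -> th j = -1 \/ th j = 1) ->
  s <= s' -> `|wave n th s' - wave n th s| <= s' - s.
Proof.
move=> th1 ss'.
have := floor_bounds s; have := floor_bounds s'.
have [ff|ff] := eqVneq (Num.floor s) (Num.floor s').
  rewrite !waveE -ff -mulrBr normrM => sf s'f.
  apply: le_trans (ler_piMl _ (wave_coef_le1 _ th1)) _ => //.
  rewrite /zdist -ff ler_norml.
  by case: (leP (s - _)) => ?; case: (leP (s' - _)) => ?; lra.
have : (Num.floor s)%:~R + 1 <= (Num.floor s')%:~R :> R.
  by rewrite -intrD1 ler_int lezD1 lt_neqAle ff le_floor.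
move=> ? s'f sf; have := ler_normB (wave n th s') (wave n th s).
have := wave_le_zdist s th1; have := wave_le_zdist s' th1.
have : zdist s' <= s' - (Num.floor s')%:~R by rewrite /zdist ge_min lexx.
have : zdist s <= 1 - (s - (Num.floor s)%:~R) by rewrite /zdist ge_min lexx orbT.
lra.
Qed.

Lemma schauder00_continuous : continuous (@schauder00 R).
Proof.
move=> t; apply: (@continuous_max R R (fun s => Num.min s (1 - s)) (cst 0)).
  apply: (@continuous_min R R idfun (fun s => 1 - s)); first exact: cvg_id.
  by apply: cvgB; [exact: cvg_cst|exact: cvg_id].
exact: cvg_cst.
Qed.

Lemma wave_continuous n th : continuous (wave n th).
Proof.
move=> t; apply: cvg_big => [|k _]; first exact: add_continuous.
apply: cvgM; first exact: cvg_cst.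
apply: (@continuous_comp _ _ _ (fun s => s - k%:R) schauder00).
  by apply: cvgB; [exact: cvg_id|exact: cvg_cst].
exact: schauder00_continuous.
Qed.

End wave.

(** * Signed Takagi-Landsberg functions *)

Lemma norm_lim_le {R : realType} (u : nat -> R) (l B : R) : u n @[n --> \oo] --> l ->
  (\forall n \near \oo, `|u n| <= B) -> `|l| <= B.
Proof.
move=> ul uB; have cvu : `|u n| @[n --> \oo] --> `|l| by exact: cvg_norm.
by rewrite -(cvg_lim _ cvu)//; apply: limr_le => //; apply: cvgP cvu.
Qed.

(** * Function series with a geometric majorant *)

Section geometric_M_test.
Context {R : realType} (f : nat -> R -> R) (a : R).
Hypothesis a_bnd : 0 < a < 1.
Hypothesis f_le : forall m t, `|f m t| <= a ^+ m.

Let S (n : nat) (t : R) := \sum_(0 <= m < n) f m t.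

Lemma sum_geometric_tail_le (m n : nat) :
  \sum_(m <= i < n) a ^+ i <= a ^+ m / (1 - a).
Proof.
have a01 := a_bnd.
have a0 : 0 <= a ^+ m / (1 - a) by apply: divr_ge0; [apply: exprn_ge0|]; lra.
have [nm|mn] := leqP n m; first by rewrite big_geq.
rewrite -(subnKC (ltnW mn)) geometric_partial_tail.
apply: geometric_le_lim; [apply: exprn_ge0| |rewrite ger0_norm]; lra.
Qed.

Lemma geometric_series_cvg t : cvgn (S ^~ t).
Proof.
have a01 := a_bnd; apply: (@normed_cvg R R (f ^~ t)).
apply: (@series_le_cvg _ _ (geometric 1 a)) => [n|n|n|].
- exact: normr_ge0.
- by rewrite /geometric /= mul1r; apply: exprn_ge0; lra.
- by rewrite /geometric /= mul1r.
- by apply: is_cvg_geometric_series; rewrite ger0_norm; lra.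
Qed.

Lemma geometric_series_tail n t : `|limn (S ^~ t) - S n t| <= a ^+ n / (1 - a).
Proof.
apply: (@norm_lim_le _ (fun N => S N t - S n t)).
  by apply: cvgB; [exact: geometric_series_cvg|exact: cvg_cst].
exists n => // N /= nN.
rewrite /S (big_cat_nat (n := n))//= addrAC subrr add0r.
apply: le_trans (ler_norm_sum _ _ _) (le_trans _ (sum_geometric_tail_le n N)).
exact: ler_sum.
Qed.

(** The bound of [geometric_series_tail] does not depend on [t]; every entourage contains a ball
    entourage of some radius e, which the tails eventually beat. *)
Lemma geometric_series_uniform (A : set R) :
  {uniform A, S n @[n --> \oo] --> (fun t => limn (S ^~ t))}.
Proof.
move=> P /uniform_nbhs [E [entE sub]].
have a01 := a_bnd; move: entE; rewrite -entourage_ballE => -[e /= e0 ballE].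
have cv0 : a ^+ n / (1 - a) @[n --> \oo] --> (0 : R).
  rewrite -[0](mul0r (1 - a)^-1); apply: cvgM; last exact: cvg_cst.
  by apply: cvg_expr; rewrite ger0_norm; lra.
have : \forall n \near \oo, a ^+ n / (1 - a) < e by exact: (cvgr_lt _ cv0).
apply: filterS => n an; apply: sub => t _; apply: ballE.
exact: le_lt_trans (geometric_series_tail n t) an.
Qed.

Lemma geometric_series_continuous (A : set R) : (forall m, continuous (f m)) ->
  {within A, continuous (fun t => limn (S ^~ t))}.
Proof.
move=> f_cont.
apply: (@uniform_limit_continuous_subspace R R A (S @ \oo)).
  exists 0%N => // n _ /=; apply: continuous_subspaceT => t.
  apply: cvg_big => [|k _]; first exact: add_continuous.
  exact: f_cont.
exact: geometric_series_uniform.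
Qed.

End geometric_M_test.

(** * The class as a family of wave series *)

Section Takagi_Landsberg.
Context {R : realType} (H : R).
Hypotheses (H_gt0 : 0 < H) (H_lt1 : H < 1).
Implicit Types (theta : nat -> nat -> R) (t h : R).

Let a : R := 2 `^ (- H).

Definition signs theta :=
  forall m k, (k < 2 ^ m)%N -> theta m k = -1 \/ theta m k = 1.

Lemma powR2_lt (r s : R) : r < s -> 2 `^ r < 2 `^ s.
Proof.
by move=> rs; rewrite /powR pnatr_eq0 /= ltr_expR ltr_pM2r// ln_gt0// ltr1n.
Qed.

(** The range of H enters through these two facts: a < 1 makes the series converge, while a > 1/2
    makes b = 2a exceed 1 and allows [sum_zdist_le]. *)
Lemma powR2N_bounds : 1 / 2 < a /\ a < 1.
Proof.
have H0 := H_gt0; have H1 := H_lt1; split.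
  have -> : 1 / 2 = 2 `^ (- 1) :> R by rewrite powR_inv1// div1r.
  by apply: powR2_lt; lra.
by rewrite -(powRr0 2); apply: powR2_lt; lra.
Qed.

Let a_gt0 : 0 < a. Proof. exact: powR_gt0. Qed.
Let a_lt1 : a < 1. Proof. by case: powR2N_bounds. Qed.
Let a_ge_half : 1 / 2 <= a. Proof. by case: powR2N_bounds => /ltW. Qed.

Lemma powR2DM (r s : R) : 2 `^ (r + s) = 2 `^ r * 2 `^ s.
Proof. by rewrite powRD// pnatr_eq0 implybT. Qed.

Lemma powR2N_expr (m : nat) : a ^+ m = 2 `^ (- (m%:R * H)).
Proof. by rewrite -powR_mulrn ?powR_ge0// -powRrM mulNr mulrC. Qed.

Definition TL_term theta m t : R := a ^+ m * wave (2 ^ m) (theta m) (2 ^+ m * t).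

(** The factor 2^(m/2) of the coefficient cancels the normalisation of the Schauder function and
    leaves 2^(-mH) = a^m. *)
Lemma schauder_level (m k : nat) t :
  2 `^ (m%:R * (2^-1 - H)) * schauder m k t =
  a ^+ m * schauder00 (2 ^+ m * t - k%:R).
Proof.
rewrite /schauder mulrA -powR2DM powR2N_expr -pmulrn; congr (2 `^ _ * _); lra.
Qed.

Lemma TL_partialE theta n t :
  TL_partial H theta n t = \sum_(0 <= m < n) TL_term theta m t.
Proof.
apply: eq_bigr => m _; rewrite /TL_term /wave !mulr_sumr.
by apply: eq_bigr => k _; rewrite mulrCA schauder_level mulrCA.
Qed.

Lemma TL_term_zdist theta m t : signs theta ->
  `|TL_term theta m t| <= a ^+ m * zdist (2 ^+ m * t).
Proof.
move=> th; have am0 : 0 <= a ^+ m by apply/exprn_ge0/ltW.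
rewrite /TL_term normrM (ger0_norm am0).
by apply: (ler_wpM2l am0); apply: wave_le_zdist; exact: th.
Qed.

Lemma TL_term_le theta m t : signs theta -> `|TL_term theta m t| <= a ^+ m.
Proof.
move=> th; apply: le_trans (TL_term_zdist _ _ th) _.
apply: ler_piMr; first by rewrite exprn_ge0 ?ltW.
by have := zdist_le_half (2 ^+ m * t); lra.
Qed.

Lemma TL_term_continuous theta m : continuous (TL_term theta m).
Proof.
move=> t; rewrite /TL_term; apply: cvgM; first exact: cvg_cst.
apply: (@continuous_comp R R R (fun s => 2 ^+ m * s) (wave (2 ^ m) (theta m))).
  by apply: cvgM; [exact: cvg_cst|exact: cvg_id].
exact: wave_continuous.
Qed.

(** The bounds on the levels hold on the whole line, so for signs [theta] this limit is continuous
    there and is a convenient representative of an element of C[0,1]. *)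
Definition TL_lim theta t : R := limn (fun n => TL_partial H theta n t).

Lemma TL_lim_continuous theta : signs theta -> continuous (TL_lim theta).
Proof.
move=> th; have a01 : 0 < a < 1 by apply/andP.
apply/continuous_subspace_setT; rewrite /TL_lim.
under eq_fun do under eq_fun do rewrite TL_partialE.
apply: (geometric_series_continuous a01) => [m t|m].
  exact: TL_term_le.
exact: TL_term_continuous.
Qed.

Lemma TL_lim_signed theta : signs theta -> signed_TL H (TL_lim theta).
Proof.
move=> th; have a01 : 0 < a < 1 by apply/andP.
have tE : TL_partial H theta =
    (fun n t => \sum_(0 <= m < n) TL_term theta m t).
  by apply/funext => n; apply/funext => t; exact: TL_partialE.
split; first exact/continuous_subspaceT/TL_lim_continuous.
exists theta; split; first exact: th.
by rewrite /TL_lim tE; apply: (geometric_series_uniform a01) => m t; exact: TL_term_le.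
Qed.

Lemma TL_cvg theta t : signs theta ->
  TL_partial H theta n t @[n --> \oo] --> TL_lim theta t.
Proof.
move=> th; have a01 : 0 < a < 1 by apply/andP.
rewrite /TL_lim (_ : (fun n => _) = (fun n => \sum_(0 <= m < n) TL_term theta m t)).
  by apply: (geometric_series_cvg a01) => m s; exact: TL_term_le.
by apply/funext => n; exact: TL_partialE.
Qed.

(** Uniform convergence is restricted to single points of [0,1]; outside this interval nothing is
    known about [x]. *)
Lemma signed_TLP (x : R -> R) : signed_TL H x ->
  exists2 theta, signs theta & {in `[0, 1], x =1 TL_lim theta}.
Proof.
move=> [_ [theta [th ux]]]; exists theta => // t t01.
have : {uniform [set t], TL_partial H theta n @[n --> \oo] --> x}.
  by apply: uniform_subset_cvg ux => s ->.
rewrite uniform_set1 => xt; apply/esym/cvg_lim => //; exact: xt.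
Qed.

Lemma TL_increment_cvg theta t h : signs theta ->
  TL_partial H theta n (t + h) - TL_partial H theta n t @[n --> \oo] -->
  TL_lim theta (t + h) - TL_lim theta t.
Proof. by move=> th; apply: cvgB; exact: TL_cvg. Qed.

(** * Bounds on the increments *)

Lemma sum_zdist_tail_le (n N : nat) t : (n <= N)%N ->
  \sum_(n <= m < N) a ^+ m * zdist (2 ^+ m * t) <= a ^+ n / (3 * (1 - a)).
Proof.
move=> nN; rewrite -{1}(add0n n) big_addn.
under eq_bigr do rewrite addnC !exprD -mulrA (mulrC (2 ^+ n)) -(mulrA (2 ^+ _)).
rewrite -mulr_sumr; apply: ler_wpM2l; first exact/exprn_ge0/ltW.
exact: sum_zdist_le.
Qed.

(** The level [n] at which the Lipschitz bound gives way to the size bound is free here; by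
    [omegaE], taking n = nu h yields the modulus. *)
Lemma TL_partial_increment_le theta (n N : nat) t h : signs theta -> 0 <= h ->
  (n <= N)%N ->
  `|TL_partial H theta N (t + h) - TL_partial H theta N t| <=
  h * (2 * a) ^+ n / (2 * a - 1) + 2 * a ^+ n / (3 * (1 - a)).
Proof.
move=> th h0 nN; rewrite !TL_partialE -sumrB.
apply: le_trans (ler_norm_sum _ _ _) _.
rewrite (big_cat_nat (n := n))//=; apply: lerD.
  have b1 : 0 < 2 * a - 1 by have [? ?] := powR2N_bounds; lra.
  have : \sum_(0 <= m < n) `|TL_term theta m (t + h) - TL_term theta m t| <=
      \sum_(0 <= m < n) h * (2 * a) ^+ m.
    apply: ler_sum => m _; have am0 : 0 <= a ^+ m by apply/exprn_ge0/ltW.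
    rewrite /TL_term -mulrBr normrM (ger0_norm am0) exprMn.
    rewrite (mulrC (2 ^+ m) (a ^+ m)) mulrCA; apply: (ler_wpM2l am0).
    have -> : h * 2 ^+ m = 2 ^+ m * (t + h) - 2 ^+ m * t by ring.
    apply: wave_lipschitz; first exact: th.
    by apply: ler_wpM2l; [exact: exprn_ge0|lra].
  move/le_trans; apply; rewrite -mulr_sumr -mulrA; apply: ler_wpM2l => //.
  (* The geometric sum is ((2a)^n - 1) / (2a - 1), whose -1 is dropped. *)
  rewrite ler_pdivlMr// big_mkord mulrC -subrX1; lra.
have th_le m : `|TL_term theta m (t + h) - TL_term theta m t| <=
    a ^+ m * zdist (2 ^+ m * (t + h)) + a ^+ m * zdist (2 ^+ m * t).
  by apply: le_trans (ler_normB _ _) (lerD _ _); exact: TL_term_zdist.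
apply: le_trans (ler_sum _ (fun m _ => th_le m)) _; rewrite big_split /=.
have := sum_zdist_tail_le (t + h) nN; have := sum_zdist_tail_le t nN; lra.
Qed.

(** The factor 2^(1-H) = b = 2a turns b^(n-1) in the first term of omega into b^n, and a^(n-1) in
    the second into 2 a^n. *)
Lemma omegaE (n : nat) h : 0 < h -> nu h = n ->
  2 `^ (1 - H) * omega H h =
  h * (2 * a) ^+ n / (2 * a - 1) + 2 * a ^+ n / (3 * (1 - a)).
Proof.
move=> h0 hn; have bE : 2 * a = 2 `^ (1 - H) by rewrite powR2DM powRr1.
have bnE : (2 * a) ^+ n = 2 `^ (n%:R * (1 - H)).
  by rewrite bE -powR_mulrn ?powR_ge0// -powRrM mulrC.
rewrite /omega h0 hn -pmulrn -/a -bE mulrDr; congr (_ + _).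
  rewrite bnE; have -> : n%:R * (1 - H) = (1 - H) + (n%:R - 1) * (1 - H) by ring.
  by rewrite (powR2DM (1 - H)) -bE mulrA; congr (_ / _); ring.
rewrite mulrA; congr (_ / _); rewrite -mulrA; congr (2 * _).
by rewrite powR2N_expr /a -powR2DM; congr (2 `^ _); ring.
Qed.

Lemma nu_nat h : 0 < h -> h < 1 -> exists n : nat, nu h = n.
Proof.
move=> h0 h1; have : 0 <= nu h.
  rewrite /nu floor_ge0 oppr_ge0 pmulr_lle0 ?invr_gt0 ?ln_gt0 ?ltr1n//.
  exact/ln_le0/ltW.
by case: (nu h) => // n _; exists n.
Qed.

Lemma omega_gt0 h : 0 < h -> h < 1 -> 0 < omega H h.
Proof.
move=> h0 h1; have [n hn] := nu_nat h0 h1.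
rewrite -(pmulr_rgt0 _ (powR_gt0 (1 - H) (ltr0n R 2))) (omegaE h0 hn).
have [a1 a2] := powR2N_bounds; have a0 := a_gt0.
apply: ltr_wpDl; last by apply: divr_gt0; [apply: mulr_gt0; [|exact: exprn_gt0]|]; lra.
by apply: divr_ge0; [apply: mulr_ge0; [|apply: exprn_ge0]|]; lra.
Qed.

Lemma TL_increment_le theta t h : signs theta -> 0 <= h -> h < 1 ->
  `|TL_lim theta (t + h) - TL_lim theta t| <= 2 `^ (1 - H) * omega H h.
Proof.
move=> th; rewrite le_eqVlt => /orP[/eqP <- _|h0 h1].
  (* For h = 0 both sides vanish, by the convention for omega. *)
  by rewrite addr0 subrr normr0 /omega ltxx mulr0.
have [n hn] := nu_nat h0 h1; rewrite (omegaE h0 hn).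
apply: norm_lim_le (TL_increment_cvg th) _; exists n => // N /= nN.
by apply: TL_partial_increment_le => //; exact: ltW.
Qed.

Definition extremal_signs t h (m k : nat) : R :=
  if 0 <= schauder m k (t + h) - schauder m k t then 1 else -1.

Lemma extremal_signsP t h : signs (extremal_signs t h).
Proof. by move=> m k _; rewrite /extremal_signs; case: ifP; [right|left]. Qed.

(** An extremal sign times its Schauder increment is the absolute value of that increment, so the
    triangle inequality suffices. *)
Lemma TL_partial_increment_extremal theta (N : nat) t h : signs theta ->
  `|TL_partial H theta N (t + h) - TL_partial H theta N t| <=
  TL_partial H (extremal_signs t h) N (t + h) -
  TL_partial H (extremal_signs t h) N t.
Proof.
move=> th; rewrite /TL_partial -!sumrB.
apply: le_trans (ler_norm_sum _ _ _) (ler_sum _ _) => m _.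
rewrite -!mulrBr normrM (ger0_norm (powR_ge0 _ _)).
apply: ler_wpM2l; first exact: powR_ge0.
rewrite -!sumrB; apply: le_trans (ler_norm_sum _ _ _) (ler_sum_nat _) => k /= km.
rewrite /extremal_signs; move: (schauder m k (t + h)) (schauder m k t) => u v.
rewrite -!mulrBr normrM; have -> : `|theta m k| = 1 by case: (th m k km) => ->; rewrite ?normrN normr1.
by case: ger0P => d; lra.
Qed.

Lemma TL_increment_extremal theta t h : signs theta ->
  `|TL_lim theta (t + h) - TL_lim theta t| <=
  TL_lim (extremal_signs t h) (t + h) - TL_lim (extremal_signs t h) t.
Proof.
move=> th; have ext := TL_increment_cvg (t := t) (h := h) (extremal_signsP t h).
have thl : `|TL_partial H theta n (t + h) - TL_partial H theta n t| @[n --> \oo]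
    --> `|TL_lim theta (t + h) - TL_lim theta t|.
  by apply: cvg_norm; exact: TL_increment_cvg.
rewrite -(cvg_lim _ ext)// -(cvg_lim _ thl)//.
apply: ler_lim; [exact: cvgP thl|exact: cvgP ext|].
by apply: nearW => N; exact: TL_partial_increment_extremal.
Qed.

End Takagi_Landsberg.

(** * The extremal function *)

Section xtilde.
Context {R : realType} (H : R).
Hypotheses (H_gt0 : 0 < H) (H_lt1 : H < 1).

Let a : R := 2 `^ (- H).
Let b : R := 2 `^ (1 - H).

Definition xtilde_signs (m k : nat) : R :=
  if (m == 0)%N || (k < 2 ^ m.-1)%N then 1 else -1.

Lemma xtilde_signsP : signs xtilde_signs.
Proof. by move=> m k _; rewrite /xtilde_signs; case: ifP; [right|left]. Qed.

Lemma xtildeE t : xtilde H t = TL_lim H xtilde_signs t.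
Proof.
rewrite /xtilde; set u := (fun n : nat => \sum_(1 <= m < n) _).
have partE n : TL_partial H xtilde_signs n.+1 t = schauder00 t + u n.+1.
  rewrite /TL_partial big_ltn//; congr (_ + _).
    rewrite mul0r powRr0 mul1r expn0 big_nat1 /xtilde_signs /= mul1r.
    by rewrite /schauder mul0r oppr0 powRr0 mul1r expr0 mul1r addr0.
  rewrite /u; apply: eq_big_nat => -[//|m] _; congr (_ * _).
  rewrite (big_cat_nat (n := (2 ^ m)%N))//= ?leq_exp2l//; congr (_ + _).
    by apply: eq_big_nat => k /andP[_ km]; rewrite /xtilde_signs /= km mul1r.
  rewrite -sumrN; apply: eq_big_nat => k /andP[mk _].
  by rewrite /xtilde_signs /= ltnNge mk mulN1r.
have cvu : u n @[n --> \oo] --> TL_lim H xtilde_signs t - schauder00 t.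
  have := TL_cvg H_gt0 H_lt1 (t := t) xtilde_signsP.
  (* The shift is needed because [partE] fails for the empty partial sum, which lacks level 0. *)
  rewrite -cvg_shiftS -[in X in _ -> X]cvg_shiftS => cvT.
  rewrite [X in X @ _](_ : _ =
      (fun n => TL_partial H xtilde_signs n.+1 t - schauder00 t)).
    by apply: cvgB => //; exact: cvg_cst.
  by apply/funext => n /=; rewrite partE addrC addKr.
by rewrite (cvg_lim _ cvu)// addrC subrK.
Qed.

(** Left of 1/2 the cell index at a level m >= 1 is below 2^(m-1), so the sign there is +1, as it is
    at level 0. *)
Lemma xtilde_term_left (m : nat) (t : R) : 0 <= t -> t < 1 / 2 ->
  TL_term H xtilde_signs m t = a ^+ m * zdist (2 ^+ m * t).
Proof.
move=> t0 t1; rewrite /TL_term waveE; congr (_ * _).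
have : 0 <= Num.floor (2 ^+ m * t) by rewrite floor_ge0 mulr_ge0// exprn_ge0.
have := floor_bounds (2 ^+ m * t).
case: (Num.floor _) => // j /andP[jt _] _.
have jm : (j < 2 ^ m)%N && ((m == 0)%N || (j < 2 ^ m.-1)%N).
  have : j%:R < 2 ^+ m / 2 :> R.
    apply: le_lt_trans jt _; rewrite -[_ / 2]mul1r mulrCA ltr_pM2l ?exprn_gt0//.
  case: m {jt} => [|m].
    by rewrite expr0 expn0 -(ltr_nat R); lra.
  rewrite exprS mulrC mulKf ?pnatr_eq0// -natrX ltr_nat /= => jm.
  by rewrite jm andbT (ltn_trans jm)// ltn_exp2l.
by move/andP: jm => [jm jm']; rewrite /= jm /xtilde_signs jm' mul1r.
Qed.

(** Stated for [m.+1] because level 0 keeps the sign +1 to the right of 1/2. *)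
Lemma xtilde_term_right (m : nat) (t : R) : 1 / 2 <= t -> t < 1 ->
  TL_term H xtilde_signs m.+1 t = - (a ^+ m.+1 * zdist (2 ^+ m.+1 * t)).
Proof.
move=> t0 t1; rewrite /TL_term waveE -mulrN; congr (_ * _).
have pm : 0 < 2 ^+ m.+1 :> R by exact: exprn_gt0.
have : ((2 ^ m)%N : int) <= Num.floor (2 ^+ m.+1 * t).
  rewrite floor_ge_int -pmulrn natrX exprSr -mulrA.
  by rewrite -[leLHS]mulr1 ler_pM2l ?exprn_gt0//; lra.
have := floor_bounds (2 ^+ m.+1 * t).
case: (Num.floor _) => // j /andP[jt _]; rewrite lez_nat => mj.
have jm : (j < 2 ^ m.+1)%N.
  rewrite -(ltr_nat R) natrX; apply: le_lt_trans jt _.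
  by rewrite -[ltRHS]mulr1 ltr_pM2l.
by rewrite /= jm /xtilde_signs /= ltnNge mj mulN1r.
Qed.

(** Level 0 is symmetric about 1/2 and cancels. For m >= 1 the number 2^m / 2 is an integer, so both
    points have the same [zdist] as 2^m s, and their opposite signs make the two values add up. *)
Lemma xtilde_partial_symmetric (N : nat) (s : R) : 0 < s -> s < 1 / 2 -> (0 < N)%N ->
  TL_partial H xtilde_signs N (1 / 2 - s) - TL_partial H xtilde_signs N (1 / 2 + s)
  = \sum_(1 <= m < N) a ^+ m * (2 * zdist (2 ^+ m * s)).
Proof.
move=> s0 s1 N0; rewrite !TL_partialE -sumrB big_ltn//.
have zhalf : zdist (1 / 2 - s) = zdist (1 / 2 + s).
  by rewrite -(zdistDz (1 / 2 - s) (-1)) -zdistN intrN; congr zdist; lra.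
rewrite xtilde_term_left; [|lra|lra].
have -> : TL_term H xtilde_signs 0 (1 / 2 + s) = a ^+ 0 * zdist (2 ^+ 0 * (1 / 2 + s)).
  rewrite /TL_term waveE; congr (_ * _).
  have -> : Num.floor (2 ^+ 0 * (1 / 2 + s)) = 0.
    by apply: floor_def; rewrite expr0 !intrD; lra.
  by rewrite expn0 /=; exact: mul1r.
rewrite !expr0 !(mul1r (1 / 2 - s), mul1r (1 / 2 + s)) zhalf subrr add0r.
apply: eq_big_nat => -[//|m] _.
rewrite xtilde_term_left ?xtilde_term_right; [|lra..].
have half : 2 ^+ m.+1 * (1 / 2) = ((2 ^ m)%N : int)%:~R :> R.
  by rewrite -pmulrn natrX exprSr -mulrA mul1r mulfV ?mulr1 ?pnatr_eq0.
by rewrite mulrBr mulrDr half !(addrC _%:~R) !zdistDz zdistN; ring.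
Qed.

(** The inverse of h is (3/2) 2^n, which lies between 2^n and 2^(n+1). *)
Lemma nu_two_thirds (n : nat) : nu (2 / 3 / 2 ^+ n : R) = n.
Proof.
have p2 : 0 < 2 ^+ n :> R by exact: exprn_gt0.
have l2 : 0 < ln 2 :> R by rewrite ln_gt0// ltr1n.
have -> : 2 / 3 / 2 ^+ n = (3 / 2 * 2 ^+ n)^-1 :> R by field; lra.
have y0 : 0 < 3 / 2 * 2 ^+ n :> R by apply: mulr_gt0; lra.
apply: floor_def; rewrite lnV ?posrE// mulNr opprK intrD -!pmulrn natr1.
rewrite ler_pdivlMr// ltr_pdivrMr// !(mulr_natl (ln 2)) -!lnXn//.
rewrite ler_ln ?posrE ?exprn_gt0// ltr_ln ?posrE ?exprn_gt0// exprS.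
by apply/andP; split; lra.
Qed.

Lemma xtilde_increment (n : nat) : (0 < n)%N -> let h := 2 / 3 / 2 ^+ n in
  TL_lim H xtilde_signs (1 / 2 - h / 2) - TL_lim H xtilde_signs (1 / 2 - h / 2 + h)
  = b * omega H h - h * b / (b - 1).
Proof.
move=> n0 h.
have [a1 a2] := powR2N_bounds H_gt0 H_lt1; rewrite -/a in a1 a2.
have p2 : 0 < 2 ^+ n :> R by exact: exprn_gt0.
have p2n : 2 <= 2 ^+ n :> R.
  by rewrite -[leLHS]expr1; apply: ler_weXn2l; rewrite ?ler1n.
have h0 : 0 < h by apply: divr_gt0 => //; lra.
have hn : h * 2 ^+ n = 2 / 3 by rewrite /h mulfVK//; lra.
have h1 : h <= 1 / 3 by nra.
have bE : b = 2 * a by rewrite /b powR2DM powRr1.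
rewrite /b (omegaE H h0 (nu_two_thirds n)) -/b bE -/a.
have -> : 1 / 2 - h / 2 + h = 1 / 2 + h / 2 by lra.
set L := LHS.
have cvL : TL_partial H xtilde_signs N (1 / 2 - h / 2) -
    TL_partial H xtilde_signs N (1 / 2 + h / 2) @[N --> \oo] --> L.
  by apply: cvgB; apply: TL_cvg => //; exact: xtilde_signsP.
have cv2 : TL_partial H xtilde_signs N (1 / 2 - h / 2) -
    TL_partial H xtilde_signs N (1 / 2 + h / 2) @[N --> \oo] -->
    \sum_(1 <= m < n) h * (2 * a) ^+ m + 2 / 3 * (a ^+ n / (1 - a)).
  (* After a shift by [n], the levels from [n] on form partial sums of a geometric series. *)
  rewrite -(cvg_shiftn n).
  rewrite [X in X @ _](_ : _ = (fun k => \sum_(1 <= m < n) h * (2 * a) ^+ m +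
      2 / 3 * series (geometric (a ^+ n) a) k)).
    apply: cvgD; first exact: cvg_cst.
    apply: cvgM; first exact: cvg_cst.
    by apply: cvg_geometric_series; rewrite ger0_norm; lra.
  apply/funext => k /=; rewrite xtilde_partial_symmetric ?addn_gt0 ?n0 ?orbT//; [|lra..].
  rewrite (big_cat_nat (n := n))//= ?leq_addl//; congr (_ + _).
    (* For m < n the nearest integer to 2^m h / 2 is 0, as 2^m h / 2 <= 2^n h / 2 = 1/3. *)
    apply: eq_big_nat => m /andP[_ mn].
    have mn2 : 2 ^+ m <= 2 ^+ n :> R by apply: ler_weXn2l; [rewrite ler1n|exact: ltnW].
    have m0 : 0 < 2 ^+ m :> R by exact: exprn_gt0.
    have e : `|2 ^+ m * (h / 2) - 0%:~R| = 2 ^+ m * (h / 2).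
      by rewrite subr0 ger0_norm// mulr_ge0//; lra.
    by rewrite (@zdistE _ _ 0) e; [rewrite exprMn; field|nra].
  rewrite addnC -geometric_partial_tail mulr_sumr; apply: eq_big_nat => m /andP[nm _].
  have -> : 2 ^+ m * (h / 2) = 2 ^+ (m - n) / 3.
    by rewrite -{1}(subnK nm) exprD /h; field; lra.
  by rewrite zdist_pow2_third; field.
rewrite (cvg_unique _ cvL cv2)// -mulr_sumr.
(* Compared with h b^n / (b - 1), the finite sum loses h / (b - 1), and the absent level 0 another
   h; together this is h b / (b - 1). *)
have : \sum_(0 <= m < n) (2 * a) ^+ m = ((2 * a) ^+ n - 1) / (2 * a - 1).
  by rewrite subrX1 big_mkord; field; lra.
rewrite big_ltn// expr0 => /(canRL (addKr _)) ->; field.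
by apply/andP; split; lra.
Qed.

(** The first term of b omega(h) gives h b^n / (b - 1) <= b omega(h). Multiplied by b / b^n, this
    bounds the defect h b / (b - 1) by omega(h) b^2 / b^n. *)
Lemma xtilde_ratio (n : nat) : (0 < n)%N -> let h := 2 / 3 / 2 ^+ n in
  b - b ^+ 2 / b ^+ n <=
  `|TL_lim H xtilde_signs (1 / 2 - h / 2 + h) - TL_lim H xtilde_signs (1 / 2 - h / 2)|
  / omega H h.
Proof.
move=> n0 /=; set h := 2 / 3 / 2 ^+ n; have p2 : 0 < 2 ^+ n :> R by exact: exprn_gt0.
have [a1 a2] := powR2N_bounds H_gt0 H_lt1; rewrite -/a in a1 a2.
have p2n : 2 <= 2 ^+ n :> R.
  by rewrite -[leLHS]expr1; apply: ler_weXn2l; rewrite ?ler1n.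
have h0 : 0 < h by apply: divr_gt0 => //; lra.
have hn : h * 2 ^+ n = 2 / 3 by rewrite /h mulfVK//; lra.
have h1 : h < 1 by nra.
have w0 := omega_gt0 H_gt0 H_lt1 h0 h1.
have bE : b = 2 * a by rewrite /b powR2DM powRr1.
have b1 : 0 < b - 1 by lra.
have bn0 : 0 < b ^+ n by apply: exprn_gt0; lra.
rewrite ler_pdivlMr// distrC (xtilde_increment n0) -/h.
apply: le_trans (ler_norm _); rewrite mulrBl lerD2l lerN2.
have : h * b ^+ n / (b - 1) <= b * omega H h.
  rewrite (omegaE H h0 (nu_two_thirds n)) -/a bE lerDl.
  apply: divr_ge0; last lra.
  by apply: mulr_ge0 => //; apply: exprn_ge0; lra.
rewrite -(ler_pM2l (x := b / b ^+ n)); last by apply: divr_gt0 => //; lra.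
congr (_ <= _); last by field; lra.
by field; apply/andP; split; lra.
Qed.

End xtilde.

(** * Maxima and upper limits of the increments *)

Lemma is_max_sup {R : realType} (A : set R) (M : R) : is_max A M -> sup A = M.
Proof.
move=> [AM MA]; apply/le_anti/andP; split; first by apply: ge_sup => //; exists M.
by apply: ub_le_sup => //; exists M.
Qed.

(** The upper limit is the infimum of suprema over right neighbourhoods of 0: ]0, 1[ gives one
    inequality, and for the other each neighbourhood contains some ]0, d[. *)
Lemma limsup_at0_eq {R : realType} (f : R -> \bar R) (c : R) :
  (forall h, 0 < h -> h < 1 -> (f h <= c%:E)%E) ->
  (forall e d : R, 0 < e -> 0 < d ->
    exists h, [/\ 0 < h, h < d & ((c - e)%:E <= f h)%E]) ->
  limsup_at0 f = c%:E.
Proof.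
move=> fub flb; apply/le_anti/andP; split; rewrite /limsup_at0 limf_esupE.
  apply: (@le_trans _ _ (ereal_sup [set f h | h in `]0, 1[%classic])).
    apply: ereal_inf_lbound; exists `]0, 1[%classic => //.
    near=> h; rewrite /= in_itv /=; apply/andP; split; near: h.
      exact: nbhs_right_gt.
    exact: nbhs_right_lt.
  apply: ge_ereal_sup => _ [h /= + <-]; rewrite in_itv /= => /andP[h0 h1].
  exact: fub.
apply: le_ereal_inf_tmp => _ [V V0 <-].
apply/lee_subgt0Pr => e e0; rewrite -EFinB.
have [d /= d0 dV] : \forall h \near (0 : R), 0 < h -> V h by exact: V0.
have [h [h0 hd fh]] := flb e d e0 d0.
apply: le_trans fh _; apply: ereal_sup_ubound; exists h => //.
by apply: dV => //=; rewrite sub0r normrN gtr0_norm.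
Unshelve. all: by end_near. Qed.

Section main.
Context {R : realType} (H : R).
Hypotheses (H_gt0 : 0 < H) (H_lt1 : H < 1).

Let b : R := 2 `^ (1 - H).

Lemma xtilde_in_signed_TL : signed_TL H (xtilde H).
Proof.
have -> : xtilde H = TL_lim H xtilde_signs by apply/funext => t; exact: xtildeE.
exact/TL_lim_signed/xtilde_signsP.
Qed.

Lemma increments_at_max (h t : R) : 0 <= h -> h < 1 -> 0 <= t -> t <= 1 - h ->
  exists2 M : R, is_max (increments_at (signed_TL H) h t) M & M <= b * omega H h.
Proof.
move=> h0 h1 t0 th1.
have sT := @extremal_signsP R t h; set x := TL_lim H (extremal_signs t h).
exists `|x (t + h) - x t|; last exact: TL_increment_le.
split; first by exists x => //; exact: TL_lim_signed.
move=> _ [y /signed_TLP[theta th yE] <-].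
rewrite !yE ?in_itv /=; [|by apply/andP; split; lra..].
by apply: le_trans (ler_norm _); exact: TL_increment_extremal.
Qed.

Section ratios.
(** Used with c = 1 for omega itself and with c = 2^(1-H) for the normalised modulus, so that b / c
    is 2^(1-H) and 1 respectively. *)
Variables (c : R) (w : R -> R).
Hypotheses (c_gt0 : 0 < c) (wE : forall h, w h = c * omega H h).

(** On [0,1] the function [x] agrees with a limit continuous on the whole line, to which the extreme
    value theorem on [0, 1 - h] applies. *)
Lemma increment_ratios_max (x : R -> R) (h : R) : signed_TL H x -> 0 < h -> h < 1 ->
  is_max (increment_ratios x w h) (sup (increment_ratios x w h)).
Proof.
move=> xTL h0 h1; have [theta th xE] := signed_TLP xTL.
have w0 : 0 < w h by rewrite wE mulr_gt0// omega_gt0.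
pose f t := `|TL_lim H theta (t + h) - TL_lim H theta t| / w h.
have ratioE : increment_ratios x w h = [set f t | t in `[0, 1 - h]%classic].
  apply: eq_imagel => t /=; rewrite in_itv /= => /andP[t0 t1].
  by rewrite /f !xE ?in_itv //=; apply/andP; split; lra.
have TLc : continuous (TL_lim H theta) by exact: TL_lim_continuous.
have fc : continuous f.
  move=> t; apply: cvgM; last exact: cvg_cst.
  apply: cvg_norm; apply: cvgB; last exact: TLc.
  apply: (@continuous_comp R R R (fun s => s + h) (TL_lim H theta)); last exact: TLc.
  by apply: cvgD; [exact: cvg_id|exact: cvg_cst].
have h1' : 0 <= 1 - h by lra.
have [t t01 tmax] := EVT_max h1' (continuous_subspaceT fc).
have fmax : is_max (increment_ratios x w h) (f t).
  by rewrite ratioE; split; [exists t|move=> _ [s s01 <-]; exact: tmax].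
by rewrite (is_max_sup fmax).
Qed.

Lemma sup_increment_ratios_le (x : R -> R) (h : R) : signed_TL H x ->
  0 < h -> h < 1 -> sup (increment_ratios x w h) <= b / c.
Proof.
move=> xTL h0 h1; have [+ _] := increment_ratios_max xTL h0 h1.
move=> [t /=]; rewrite in_itv /= => /andP[t0 t1] <-.
have w0 := omega_gt0 H_gt0 H_lt1 h0 h1.
rewrite wE ler_pdivrMr ?mulr_gt0// mulrA divfK ?gt_eqF//.
have [M [_ Mub] /(le_trans _)] := increments_at_max (ltW h0) h1 t0 t1.
by apply; apply: Mub; exists x.
Qed.

(** Take h = (2/3) 2^-n with n so large that h < d and the defect b^2 / (c b^n) from [xtilde_ratio]
    is below e. *)
Lemma sup_xtilde_ratios_ge (e d : R) : 0 < e -> 0 < d ->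
  exists h, [/\ 0 < h, h < 1, h < d &
    b / c - e <= sup (increment_ratios (xtilde H) w h)].
Proof.
move=> e0 d0.
have [a1 a2] := powR2N_bounds H_gt0 H_lt1.
have bE : b = 2 * 2 `^ (- H) by rewrite /b powR2DM powRr1.
have b1 : 1 < b by lra.
have hc : 2 / 3 / 2 ^+ n @[n --> \oo] --> (0 : R).
  rewrite -[X in _ --> X](mulr0 (2 / 3)).
  apply: cvgM; first exact: cvg_cst.
  under eq_fun do rewrite -exprVn.
  by apply: cvg_expr; rewrite ger0_norm; lra.
have bc : b ^+ 2 / c / b ^+ n @[n --> \oo] --> (0 : R).
  rewrite -[X in _ --> X](mulr0 (b ^+ 2 / c)).
  apply: cvgM; first exact: cvg_cst.
  under eq_fun do rewrite -exprVn.
  by apply: cvg_expr; rewrite ger0_norm ?invr_ge0 ?invf_lt1; lra.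
have : \forall n \near \oo, [/\ 2 / 3 / 2 ^+ n < d, b ^+ 2 / c / b ^+ n < e &
    (0 < n)%N].
  near=> n; split; near: n.
  - exact: (cvgr_lt _ hc).
  - exact: (cvgr_lt _ bc).
  - exact: nbhs_infty_gt.
move=> [n _ /(_ n (leqnn n))[hd be n0]].
have p2 : 0 < 2 ^+ n :> R by exact: exprn_gt0.
have p2n : 2 <= 2 ^+ n :> R.
  by rewrite -[leLHS]expr1; apply: ler_weXn2l; rewrite ?ler1n.
have := xtilde_ratio H_gt0 H_lt1 n0; move: hd => /=; set h := 2 / 3 / 2 ^+ n => hd.
have h0 : 0 < h by apply: divr_gt0 => //; lra.
have hn : h * 2 ^+ n = 2 / 3 by rewrite /h mulfVK//; lra.
have h1 : h <= 1 / 3 by nra.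
have h1' : h < 1 by lra.
rewrite -/b => ratio; exists h; split => //.
have [_ ub] := increment_ratios_max xtilde_in_signed_TL h0 h1'.
apply: le_trans (ub _ _); last first.
  by exists (1 / 2 - h / 2) => //=; rewrite in_itv /=; apply/andP; split; lra.
rewrite !xtildeE// wE invfM mulrCA.
have c0 : 0 <= c^-1 by rewrite invr_ge0 ltW.
apply: le_trans (ler_wpM2l c0 ratio).
have -> : c^-1 * (b - b ^+ 2 / b ^+ n) = b / c - b ^+ 2 / c / b ^+ n by ring.
lra.
Unshelve. all: by end_near. Qed.

Lemma limsup_xtilde_ratios :
  limsup_at0 (fun h => (sup (increment_ratios (xtilde H) w h))%:E) = (b / c)%:E.
Proof.
apply: limsup_at0_eq => [h h0 h1|e d e0 d0].
  by rewrite lee_fin; apply: sup_increment_ratios_le => //; exact: xtilde_in_signed_TL.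
by have [h [? ? ? ?]] := sup_xtilde_ratios_ge e0 d0; exists h; rewrite lee_fin.
Qed.

(** The upper bound b / c is uniform over the class, and [xtilde H], a member of it, already comes
    arbitrarily close. *)
Lemma limsup_signed_TL_ratios :
  limsup_at0 (fun h =>
    ereal_sup [set (sup (increment_ratios x w h))%:E | x in signed_TL H])
  = (b / c)%:E.
Proof.
apply: limsup_at0_eq => [h h0 h1|e d e0 d0].
  by apply: ge_ereal_sup => _ [x xTL <-]; rewrite lee_fin sup_increment_ratios_le.
have [h [h0 _ hd he]] := sup_xtilde_ratios_ge e0 d0; exists h; split => //.
apply: (@le_trans _ _ (sup (increment_ratios (xtilde H) w h))%:E).
  by rewrite lee_fin.
by apply: ereal_sup_ubound; exists (xtilde H) => //; exact: xtilde_in_signed_TL.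
Qed.

End ratios.

End main.

Theorem theorem2p8 (R : realType) (H : R) (H_gt0 : 0 < H) (H_lt1 : H < 1) :
  let X : set (R -> R) := signed_TL H in
  let xt : R -> R := xtilde H in
  let w : R -> R := omega H in
  let w' : R -> R := fun h => 2 `^ (1 - H) * omega H h in
  [/\ (* (a) *)
      forall h t : R, 0 <= h -> h < 1 -> 0 <= t -> t <= 1 - h ->
        exists2 M : R, is_max (increments_at X h t) M &
                       M <= 2 `^ (1 - H) * w h,
      (* (b); all the maxima over t are attained *)
      (forall h : R, 0 < h -> h < 1 ->
         is_max (increment_ratios xt w h) (sup (increment_ratios xt w h))) /\
      limsup_at0 (fun h => (sup (increment_ratios xt w h))%:E)
        = (2 `^ (1 - H))%:E
    & (* (b), in particular *)
      [/\ forall (x : R -> R) (h : R), X x -> 0 < h -> h < 1 ->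
            is_max (increment_ratios x w' h) (sup (increment_ratios x w' h)),
          forall h : R, 0 < h -> h < 1 ->
            is_max (increment_ratios xt w' h) (sup (increment_ratios xt w' h)),
          limsup_at0 (fun h =>
            ereal_sup [set (sup (increment_ratios x w' h))%:E | x in X])
          = limsup_at0 (fun h => (sup (increment_ratios xt w' h))%:E)
        & limsup_at0 (fun h => (sup (increment_ratios xt w' h))%:E) = 1%:E]].
Proof.
move=> X xt w w'.
have b0 : 0 < 2 `^ (1 - H) by exact: powR_gt0.
have wE h : w h = 1 * omega H h by rewrite mul1r.
have xtX : signed_TL H xt by exact: xtilde_in_signed_TL.
split.
- by move=> h t; exact: increments_at_max.
- split; first by move=> h; exact: (increment_ratios_max H_gt0 H_lt1 ltr01 wE).
  by rewrite (limsup_xtilde_ratios H_gt0 H_lt1 ltr01 wE) divr1.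
- have w'E h : w' h = 2 `^ (1 - H) * omega H h by [].
  have lim1 := limsup_xtilde_ratios H_gt0 H_lt1 b0 w'E.
  have lim2 := limsup_signed_TL_ratios H_gt0 H_lt1 b0 w'E.
  rewrite divff ?gt_eqF// in lim1 lim2.
  split.
  + by move=> x h; exact: (increment_ratios_max H_gt0 H_lt1 b0 w'E).
  + by move=> h; exact: (increment_ratios_max H_gt0 H_lt1 b0 w'E).
  + by rewrite lim1 lim2.
  + exact: lim1.
Qed.
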